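(* Let $r\ge 1$, let $\Phi^+$ be the set of positive roots of $\mathfrak{sl}_{r+1}$ (with simple roots $\alpha_1,\dots,\alpha_r$), and let $\mathcal{T}(\infty)$ be the set of marginally large tableaux described in the context. Then, as an identity of formal power series in $z_1,\dots,z_r$ with coefficients in $\mathbb{Z}[t^{-1}]$, \[ \prod_{\alpha\in\Phi^+} \frac{1-t^{-1}\bm z^{\alpha}}{1-\bm z^{\alpha}} = \sum_{b\in \mathcal{T}(\infty)} (1-t^{-1})^{\operatorname{seg}(b)} \bm z^{-{\rm wt}(b)}. \]
   Context: Tableaux are in English convention (left-justified rows, row lengths weakly decreasing downward). $\mathcal{T}(\infty)$ is the set of tableaux $b$ such that: (1) entries lie in $\{1,2,\dots,r+1\}$; (2) $b$ is semistandard (entries weakly increase along rows, strictly increase down columns) and has exactly $r$ rows; (3) for $1\le j\le r$, the entry in row $j$ of the leftmost column is $j$; (4) $b$ is marginally large: for every $1\le i\le r$, the number of entries equal to $i$ in row $i$ exceeds the total number of boxes in row $i+1$ by exactly one (row $r+1$ being empty). For $2\le k\le r+1$, a $k$-segment of $b$ is a (maximal, necessarily consecutive) run of boxes with entry $k$ in some row $j$ with $1\le j\le k-1$ (the boxes equal to $k$ in row $k$ are not counted); so $\operatorname{seg}_k(b)$, the number of $k$-segments, equals the number of rows $j<k$ of $b$ containing the entry $k$, and $\operatorname{seg}(b)=\sum_{k=2}^{r+1}\operatorname{seg}_k(b)$. The weight of $b$ is defined by $-{\rm wt}(b)=\sum (\alpha_i+\alpha_{i+1}+\cdots+\alpha_{j-1})$,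 the sum running over all boxes of $b$ lying in a row $i$ and having entry $j>i$. For $\beta=\sum_i c_i\alpha_i$ we write $\bm z^{\beta}=\prod_i z_i^{c_i}$; the positive roots are $\alpha_i+\cdots+\alpha_j$ for $1\le i\le j\le r$, and $t$ is an indeterminate. *)

(* Defs.v *)
From HB Require Import structures.
From mathcomp Require Import all_boot all_order all_algebra.
From mathcomp Require Import boolp classical_sets functions cardinality fsbigop.
From mathcomp.multinomials Require Import mpoly.

Set Implicit Arguments.
Unset Strict Implicit.
Unset Printing Implicit Defensive.

From mathcomp Require Import zify.

Import GRing.Theory.

Local Open Scope ring_scope.

Record fps (n : nat) (R : Type) := Fps { fcoef : 'X_{1..n} -> R }.

HB.instance Definition _ n R := gen_eqMixin (fps n R).
HB.instance Definition _ n R := gen_choiceMixin (fps n R).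

Lemma fpsP n R (f g : fps n R) : (fcoef f =1 fcoef g) <-> f = g.
Proof.
split=> [|-> //]; case: f g => [f] [g] /= fg.
by congr Fps; apply: funext.
Qed.

Section FpsZmodule.
Variables (n : nat) (V : zmodType).
Implicit Types f g h : fps n V.

Definition fps_zero : fps n V := Fps (fun=> 0).
Definition fps_opp f : fps n V := Fps (fun m => - fcoef f m).
Definition fps_add f g : fps n V := Fps (fun m => fcoef f m + fcoef g m).

Fact fps_addA : associative fps_add.
Proof. by move=> f g h; apply/fpsP=> m; rewrite /= addrA. Qed.
Fact fps_addC : commutative fps_add.
Proof. by move=> f g; apply/fpsP=> m; rewrite /= addrC. Qed.
Fact fps_add0 : left_id fps_zero fps_add.
Proof. by move=> f; apply/fpsP=> m; rewrite /= add0r. Qed.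
Fact fps_addN : left_inverse fps_zero fps_opp fps_add.
Proof. by move=> f; apply/fpsP=> m; rewrite /= addNr. Qed.

HB.instance Definition _ := GRing.isZmodule.Build (fps n V)
  fps_addA fps_addC fps_add0 fps_addN.

Lemma fcoef0 m : fcoef (0 : fps n V) m = 0. Proof. by []. Qed.
Lemma fcoefN f m : fcoef (- f) m = - fcoef f m. Proof. by []. Qed.
Lemma fcoefD f g m : fcoef (f + g) m = fcoef f m + fcoef g m.
Proof. by []. Qed.
Lemma fcoefB f g m : fcoef (f - g) m = fcoef f m - fcoef g m.
Proof. by []. Qed.

End FpsZmodule.

Section FpsRing.
Variables (n : nat) (R : comNzRingType).
Implicit Types (f g h : fps n R) (m k : 'X_{1..n}) (c : R).

Definition fpsX m : fps n R := Fps (fun k => (k == m)%:R).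

Definition fps_mul f g : fps n R := Fps (fun m =>
  \sum_(k : 'X_{1..n < (mdeg m).+1, (mdeg m).+1} | m == (k.1 + k.2)%MM)
    fcoef f k.1 * fcoef g k.2).

Definition fps_scale c f : fps n R := Fps (fun m => c * fcoef f m).

(* The ring axioms are transferred from {mpoly R[n]} by truncation: up to
   degree d, multiplying series amounts to multiplying their truncations. *)
Definition ftrunc d f : {mpoly R[n]} :=
  \sum_(k : 'X_{1..n < d}) fcoef f k *: 'X_[k].

Lemma mcoeff_ftrunc d f m : (mdeg m < d)%N -> (ftrunc d f)@_m = fcoef f m.
Proof.
move=> md; rewrite /ftrunc linear_sum /= (bigD1 (BMultinom md)) //=.
rewrite mcoeffZ mcoeffX eqxx mulr1 big1 ?addr0 // => k; rewrite bmeqP /=.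
by move=> km; rewrite mcoeffZ mcoeffX (negPf km) mulr0.
Qed.

Lemma eq_mcoeffM d (p p' q q' : {mpoly R[n]}) m : (mdeg m < d)%N ->
  (forall k, (mdeg k < d)%N -> p@_k = p'@_k) ->
  (forall k, (mdeg k < d)%N -> q@_k = q'@_k) -> (p * q)@_m = (p' * q')@_m.
Proof.
move=> md pp' qq'; rewrite !mcoeffM; apply: eq_bigr => k _.
by rewrite pp' ?qq' //; apply: leq_trans (bmdeg _) _.
Qed.

Lemma fcoef_mul_ftrunc d f g m : (mdeg m < d)%N ->
  fcoef (fps_mul f g) m = (ftrunc d f * ftrunc d g)@_m.
Proof.
move=> md; rewrite mcoeffM /=; apply: eq_bigr => k _.
by rewrite !mcoeff_ftrunc //; apply: leq_trans (bmdeg _) _.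
Qed.

Lemma mcoeff_ftruncM d f g m : (mdeg m < d)%N ->
  (ftrunc d (fps_mul f g))@_m = (ftrunc d f * ftrunc d g)@_m.
Proof. by move=> md; rewrite mcoeff_ftrunc // (fcoef_mul_ftrunc _ _ md). Qed.

Lemma mcoeff_ftrunc1 d m : (mdeg m < d)%N -> (ftrunc d (fpsX 0))@_m = 1@_m.
Proof. by move=> md; rewrite mcoeff_ftrunc // mcoeff1. Qed.

Fact fps_mulA : associative fps_mul.
Proof.
move=> f g h; apply/fpsP=> m.
rewrite !(fcoef_mul_ftrunc _ _ (ltnSn _)).
transitivity (ftrunc (mdeg m).+1 f *
   (ftrunc (mdeg m).+1 g * ftrunc (mdeg m).+1 h))@_m.
  by apply: eq_mcoeffM (ltnSn _) _ _ => // k; apply: mcoeff_ftruncM.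
rewrite mulrA; apply: eq_mcoeffM (ltnSn _) _ _ => // k km.
by rewrite mcoeff_ftruncM.
Qed.

Fact fps_mulC : commutative fps_mul.
Proof.
by move=> f g; apply/fpsP=> m; rewrite !(fcoef_mul_ftrunc _ _ (ltnSn _)) mulrC.
Qed.

Fact fps_mul1 : left_id (fpsX 0) fps_mul.
Proof.
move=> f; apply/fpsP=> m; rewrite (fcoef_mul_ftrunc _ _ (ltnSn _)).
rewrite -(mcoeff_ftrunc f (ltnSn (mdeg m))) -[in RHS](mul1r (ftrunc _ f)).
by apply: eq_mcoeffM (ltnSn _) _ _ => // k; apply: mcoeff_ftrunc1.
Qed.

Fact fps_mulD : left_distributive fps_mul +%R.
Proof.
move=> f g h; apply/fpsP=> m /=; rewrite -big_split /=.
by apply: eq_bigr => k _; rewrite mulrDl.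
Qed.

Fact fps_1neq0 : fpsX 0 != 0.
Proof.
apply/eqP=> /fpsP /(_ 0%MM) /=; rewrite eqxx => /eqP.
by rewrite oner_eq0.
Qed.

HB.instance Definition _ := GRing.Zmodule_isComNzRing.Build (fps n R)
  fps_mulA fps_mulC fps_mul1 fps_mulD fps_1neq0.

Fact fps_scaleA c c' f : fps_scale c (fps_scale c' f) = fps_scale (c * c') f.
Proof. by apply/fpsP=> m /=; rewrite mulrA. Qed.
Fact fps_scale1 : left_id 1 fps_scale.
Proof. by move=> f; apply/fpsP=> m /=; rewrite mul1r. Qed.
Fact fps_scaleDr : right_distributive fps_scale +%R.
Proof. by move=> c f g; apply/fpsP=> m /=; rewrite mulrDr. Qed.
Fact fps_scaleDl f : {morph fps_scale^~ f : c c' / c + c'}.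
Proof. by move=> c c'; apply/fpsP=> m /=; rewrite mulrDl. Qed.

HB.instance Definition _ := GRing.Zmodule_isLmodule.Build R (fps n R)
  fps_scaleA fps_scale1 fps_scaleDr fps_scaleDl.

Fact fps_scaleAl c f g : c *: (f * g) = (c *: f) * g.
Proof.
apply/fpsP=> m /=; rewrite mulr_sumr.
by apply: eq_bigr => k _; rewrite mulrA.
Qed.

HB.instance Definition _ := GRing.Lmodule_isLalgebra.Build R (fps n R)
  fps_scaleAl.
HB.instance Definition _ := GRing.Lalgebra_isComAlgebra.Build R (fps n R).

Lemma fcoefM f g m : fcoef (f * g) m =
  \sum_(k : 'X_{1..n < (mdeg m).+1, (mdeg m).+1} | m == (k.1 + k.2)%MM)
    fcoef f k.1 * fcoef g k.2.
Proof. by []. Qed.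

Lemma fcoefZ c f m : fcoef (c *: f) m = c * fcoef f m.
Proof. by []. Qed.

Lemma fcoef1 m : fcoef (1 : fps n R) m = (m == 0%MM)%:R.
Proof. by []. Qed.

Lemma fcoefX m k : fcoef (fpsX m) k = (k == m)%:R.
Proof. by []. Qed.

Lemma fps_unit_choice f :
  {g | if `[< exists h, h * f = 1 >] then g * f = 1 else g = f}.
Proof.
by apply: cid; case: asboolP => [[h hf]|_]; [exists h | exists f].
Qed.

Definition fps_unit : {pred fps n R} := fun f => `[< exists h, h * f = 1 >].
Definition fps_inv f : fps n R := sval (fps_unit_choice f).

Fact fps_mulV : {in fps_unit, left_inverse 1 fps_inv *%R}.
Proof.
move=> f; rewrite unfold_in /fps_inv => uf.
by case: (fps_unit_choice f) => g /=; rewrite uf.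
Qed.
Fact fps_unitP f g : g * f = 1 -> fps_unit f.
Proof. by move=> gf; apply/asboolP; exists g. Qed.
Fact fps_inv_out : {in [predC fps_unit], fps_inv =1 id}.
Proof.
move=> f; rewrite inE unfold_in /fps_inv => /negPf uf.
by case: (fps_unit_choice f) => g /=; rewrite uf.
Qed.

HB.instance Definition _ := GRing.ComNzRing_hasMulInverse.Build (fps n R)
  fps_mulV fps_unitP fps_inv_out.

Lemma fcoef_expr_lt f (k : nat) m :
  fcoef f 0%MM = 0 -> (mdeg m < k)%N -> fcoef (f ^+ k) m = 0.
Proof.
move=> f0; elim: k m => // k IHk m; rewrite ltnS => mk.
rewrite exprS fcoefM big1 // => -[i j] /=.
move: (bmnm i) (bmnm j) => {}i {}j /eqP mij.
have [-> | i0] := eqVneq i 0%MM; first by rewrite f0 mul0r.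
have dm : mdeg m = (mdeg i + mdeg j)%N by rewrite {1}mij mdegD.
rewrite IHk ?mulr0 //; apply: leq_trans mk; rewrite dm -[ltnLHS]add0n.
by rewrite ltn_add2r lt0n mdeg_eq0.
Qed.

(* In particular every 1 - z^a with a != 0 is invertible. *)
Lemma fps_unit1B f : fcoef f 0%MM = 0 -> 1 - f \is a GRing.unit.
Proof.
move=> f0.
have fcoef_sum (I : finType) (F : I -> fps n R) m :
    fcoef (\sum_i F i) m = \sum_i fcoef (F i) m.
  by apply: (big_morph (fun h => fcoef h m)).
pose g : fps n R := Fps (fun m => fcoef (\sum_(k < (mdeg m).+1) f ^+ k) m).
suff gf : g * (1 - f) = 1 by apply/unitrPr; exists g; rewrite mulrC.
apply/fpsP=> m; pose d := (mdeg m).+1.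
transitivity (fcoef ((\sum_(k < d) f ^+ k) * (1 - f)) m).
  rewrite !fcoefM; apply: eq_bigr => -[i j] /= _; congr (_ * _).
  have id : ((mdeg i).+1 <= d)%N by apply: bmdeg.
  rewrite !fcoef_sum (big_ord_widen d (fun k : nat => fcoef (f ^+ k) i) id).
  rewrite [RHS](bigID (fun k : 'I_d => (k < (mdeg i).+1)%N)) /=.
  rewrite [X in _ + X]big1 ?addr0 // => k; rewrite -leqNgt => ik.
  exact: fcoef_expr_lt.
rewrite mulrC -opprB mulNr -subrX1 opprB fcoefB.
by rewrite (fcoef_expr_lt f0) ?subr0.
Qed.

(* Sums of possibly infinite families, taken coefficientwise; the value is
   meaningful only for summable families. *)
Definition fps_summable (T : choiceType) (A : set T) (F : T -> fps n R) :=
  forall m, finite_set [set b | A b /\ fcoef (F b) m <> 0].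

Definition fps_sum (T : choiceType) (A : set T) (F : T -> fps n R) : fps n R :=
  Fps (fun m => \sum_(b \in A) fcoef (F b) m).

End FpsRing.

Notation "''z^' m" := (fpsX _ m) (at level 8, m at level 2, format "''z^' m").

(* An element \sum_i c_i alpha_i of the positive cone of the root lattice is
   encoded by the monomial whose exponent at the (0-based) index i-1 is c_i;
   thus the simple root alpha_(k+1) is U_(k), and root_sum r i j is
   alpha_i + ... + alpha_j. *)
Definition root_sum r (i j : nat) : 'X_{1..r} :=
  (\sum_(k < r | (i <= k.+1 <= j)%N) U_(k))%MM.

Definition pos_roots r : seq 'X_{1..r} :=
  [seq root_sum r i j | i <- iota 1 r, j <- iota i (r.+1 - i)].

Lemma root_sumE r i j (k : 'I_r) : root_sum r i j k = (i <= k.+1 <= j)%N.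
Proof.
rewrite mnm_sumE; have [kij|kij] := boolP (_ <= _ <= _)%N.
  rewrite (bigD1 k) //= mnm1E eqxx big1 // => l /andP[_ lk].
  by rewrite mnm1E (negPf lk).
rewrite big1 // => l lij; rewrite mnm1E.
by case: eqVneq => // lk; rewrite lk (negPf kij) in lij.
Qed.

Lemma pos_roots_uniq r : uniq (pos_roots r).
Proof.
apply: allpairs_uniq_dep; [exact: iota_uniq | by move=> *; exact: iota_uniq |].
move=> u v /allpairsPdep[a [b [+ + ->]]] /allpairsPdep[a' [b' [+ + ->]]] /=.
rewrite !mem_iota => ha hb ha' hb' /mnmP E.
have le x : (0 < x <= r)%N -> (a <= x <= b)%N = (a' <= x <= b')%N.
  case: x => // x xr; move: (E (Ordinal xr)); rewrite !root_sumE.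
  by do 2![case: (_ && _)].
suff [-> ->] : a = a' /\ b = b' by [].
by move: (le a) (le a') (le b) (le b'); lia.
Qed.

(* The sequence of rows, from top to bottom (English convention). *)
Definition tableau := seq (seq nat).

(* Rows are numbered from 1; trow b j is empty if b has less than j rows. *)
Definition trow (b : tableau) (j : nat) : seq nat := nth [::] b j.-1.

Definition semistandard (b : tableau) : Prop :=
  [/\ [::] \notin b,
      sorted geq [seq size s | s <- b],
      all (sorted leq) b
    & forall j c : nat, (0 < j)%N -> (c < size (trow b j.+1))%N ->
        (nth 0%N (trow b j) c < nth 0%N (trow b j.+1) c)%N].

Definition marginally_large r (b : tableau) : Prop :=
  forall i : nat, (1 <= i <= r)%N ->
    count_mem i (trow b i) = (size (trow b i.+1)).+1.

Definition Tinf r : set tableau :=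
  [set b | [/\ all (all (fun x => (1 <= x <= r.+1)%N)) b,
               semistandard b /\ size b = r,
               forall j : nat, (1 <= j <= r)%N -> head 0%N (trow b j) = j
             & marginally_large r b]].

(* The boxes of s at the (0-based) positions p, ..., q-1 form a maximal run of
   boxes with entry k. *)
Definition is_run (k : nat) (s : seq nat) (p q : nat) : bool :=
  [&& (p < q <= size s)%N,
      all (fun c => nth 0%N s c == k) (iota p (q - p)),
      (p == 0%N) || (nth 0%N s p.-1 != k)
    & (q == size s) || (nth 0%N s q != k)].

Definition runs (k : nat) (s : seq nat) : seq (nat * nat) :=
  [seq pq <- [seq (p, q) | p <- iota 0 (size s), q <- iota 0 (size s).+1]
     | is_run k s pq.1 pq.2].

Definition seg_at (b : tableau) (k : nat) : nat :=
  (\sum_(1 <= j < k) size (runs k (trow b j)))%N.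

Definition seg r (b : tableau) : nat := (\sum_(2 <= k < r.+2) seg_at b k)%N.

(* This is -wt(b): a box in row i with entry j > i contributes
   alpha_i + ... + alpha_(j-1). *)
Definition neg_wt r (b : tableau) : 'X_{1..r} :=
  (\sum_(1 <= i < r.+1) \sum_(j <- trow b i | (i < j)%N) root_sum r i j.-1)%MM.

Lemma size_runs k s : sorted leq s -> size (runs k s) = (k \in s).
Proof.
move=> ss.
have mono x y : (x <= y < size s)%N -> (nth 0%N s x <= nth 0%N s y)%N.
  move=> /andP[xy ys]; apply: (sorted_leq_nth leq_trans leqnn 0%N ss) => //.
  by rewrite inE (leq_ltn_trans xy ys).
have us : uniq (runs k s).
  apply: filter_uniq; apply: allpairs_uniq; rewrite ?iota_uniq //.
  by case=> ? ? [].
have mem p q : ((p, q) \in runs k s) = is_run k s p q.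
  rewrite mem_filter andb_idr // => /and4P[/andP[pq qs] _ _ _].
  by apply: allpairs_f; rewrite mem_iota ?(leq_trans pq).
have [ks|ks] := boolP (k \in s); last first.
  apply/eqP; rewrite size_eq0; apply/eqP; case E: (runs k s) => [//|[p q] l].
  have /= : (p, q) \in runs k s by rewrite E mem_head.
  rewrite mem => /and4P[/andP[pq qs] /allP /(_ p)].
  rewrite mem_iota leqnn /= subnKC ?(ltnW pq) // pq => /(_ isT) /eqP sp.
  by move: ks; rewrite -sp mem_nth // (leq_trans pq).
pose p := index k s; pose q := (p + find (predC1 k) (drop p s))%N.
have ps : (p < size s)%N by rewrite index_mem.
have sp : nth 0%N s p = k by apply: nth_index.
have q_le : (q <= size s)%N.
  by rewrite -(subnKC (ltnW ps)) leq_add2l -size_drop find_size.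
have nthE x : (x < size s)%N -> (nth 0%N s x == k) = (p <= x < q)%N.
  move=> xs; have [px|xp] := leqP p x; last exact: before_find xp.
  have [xq|qx] /= := ltnP x q.
    have := @before_find _ 0%N (predC1 k) (drop p s) (x - p)%N.
    rewrite ltn_subLR // -/q xq => /(_ isT).
    by rewrite nth_drop subnKC //= => /negbFE.
  have : has (predC1 k) (drop p s).
    rewrite has_find size_drop -(ltn_add2l p) subnKC ?(ltnW ps) //.
    exact: leq_ltn_trans qx xs.
  move/(nth_find 0%N); rewrite nth_drop -/q /= => sq.
  have := mono p q; rewrite leq_addr (leq_ltn_trans qx xs) sp => /(_ isT).
  have := mono q x; rewrite qx xs => /(_ isT); lia.
suff run p' q' : is_run k s p' q' = (p' == p) && (q' == q).
  suff -> : size (runs k s) = size [:: (p, q)] by [].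
  apply: perm_size; apply: uniq_perm => // -[p' q'].
  by rewrite mem run inE.
have pq : (p < q)%N by have := nthE p ps; rewrite sp eqxx leqnn /= => <-.
apply/idP/idP.
  case/and4P=> /andP[pq' qs'] /allP al bp bq.
  have /al : p' \in iota p' (q' - p') by rewrite mem_iota; lia.
  have /al : q'.-1 \in iota p' (q' - p') by rewrite mem_iota; lia.
  rewrite !nthE; [move=> q1 p1 | lia | lia].
  have := bp; rewrite nthE; last lia.
  case: (eqVneq q' (size s)) bq => /= [|q2]; first lia.
  by rewrite nthE; lia.
case/andP=> /eqP-> /eqP->; rewrite /is_run pq q_le /=; apply/and3P; split.
- by apply/allP => x; rewrite mem_iota => xpq; rewrite nthE; lia.
- by case: (eqVneq p 0%N) => //= p0; rewrite nthE; lia.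
- by case: (eqVneq q (size s)) => //= q0; rewrite nthE; lia.
Qed.

(* Z[1/t] is encoded as {poly int}, whose variable stands for 1/t. *)
Definition tinv : {poly int} := 'X.

(* Main.v *)
Require Import Defs.
From mathcomp Require Import all_boot all_order all_algebra.
From mathcomp Require Import boolp classical_sets functions cardinality fsbigop.
From mathcomp.multinomials Require Import mpoly.
From mathcomp Require Import zify ring.

(** A marginally large tableau is determined by the numbers c_(i,j), for
    1 <= i <= j <= r, of entries j+1 in row i, and these can be arbitrary: the
    number of entries i in row i is forced, from the bottom row up.  The weight is
    the sum of the c_(i,j) (alpha_i + ... + alpha_j), and seg counts the nonzero
    c_(i,j).  So the sum over tableaux is the expansion of the product of the
    geometric series (1 - c z^a) / (1 - z^a) = 1 + (1 - c) sum_(k >= 1) z^(k a),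
    c = 1/t.  At a monomial of degree d only the terms k <= d matter, so each
    coefficient is obtained by distributing a finite product of finite sums. *)

Set Implicit Arguments.
Unset Strict Implicit.
Unset Printing Implicit Defensive.

Import GRing.Theory.

Local Open Scope ring_scope.

(** * Monomial series and truncated geometric series *)

Lemma fcoef_sum n (V : zmodType) (I : Type) (s : seq I) (P : pred I)
    (F : I -> fps n V) m :
  fcoef (\sum_(i <- s | P i) F i) m = \sum_(i <- s | P i) fcoef (F i) m.
Proof. by apply: (big_morph (fun h => fcoef h m)). Qed.

Section Monomials.
Variables (n : nat) (R : comNzRingType).
Implicit Types (a b m : 'X_{1..n}) (c : R).

Lemma fpsXD a b : 'z^(a + b) = 'z^a * 'z^b :> fps n R.
Proof.
apply/fpsP=> m; rewrite [RHS](fcoef_mul_ftrunc _ _ (ltnSn (mdeg m))).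
transitivity (('X_[a] * 'X_[b] : {mpoly R[n]})@_m).
  by rewrite -mpolyXD mcoeffX fcoefX eq_sym.
by apply: eq_mcoeffM (ltnSn _) _ _ => k km;
  rewrite mcoeff_ftrunc // fcoefX mcoeffX eq_sym.
Qed.

Lemma fpsX_sum (I : Type) (s : seq I) (P : pred I) (F : I -> 'X_{1..n}) :
  'z^(\sum_(i <- s | P i) F i)%MM = \prod_(i <- s | P i) 'z^(F i) :> fps n R.
Proof. exact: (big_morph _ fpsXD erefl). Qed.

Lemma fpsXMn a k : 'z^(a *+ k) = 'z^a ^+ k :> fps n R.
Proof.
elim: k => [|k IHk]; first by rewrite mulm0n expr0.
by rewrite mulmS fpsXD IHk exprS.
Qed.

(** Congruence modulo the series all of whose terms have degree at least [d]; it is compatible with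
    products. *)
Definition fps_eq_upto d (f g : fps n R) :=
  forall m, (mdeg m < d)%N -> fcoef f m = fcoef g m.

Lemma fps_eq_upto_mul d f f' g g' :
  fps_eq_upto d f f' -> fps_eq_upto d g g' -> fps_eq_upto d (f * g) (f' * g').
Proof.
move=> ff' gg' m md; rewrite !fcoefM; apply: eq_bigr => -[i j] _ /=.
by rewrite ff' ?gg' // (leq_trans (bmdeg _)).
Qed.

Lemma fps_eq_upto_prod d (I : Type) (s : seq I) (P : pred I)
    (F G : I -> fps n R) :
  (forall i, P i -> fps_eq_upto d (F i) (G i)) ->
  fps_eq_upto d (\prod_(i <- s | P i) F i) (\prod_(i <- s | P i) G i).
Proof.
by move=> FG; apply: big_ind2 => // f f' g g'; apply: fps_eq_upto_mul.
Qed.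

Lemma fcoef_fpsXM_lt a (f : fps n R) m :
  (mdeg m < mdeg a)%N -> fcoef ('z^a * f) m = 0.
Proof.
move=> ma; rewrite fcoefM big1 // => -[i j] /= /eqP mij.
case: eqP => [ia|_]; last by rewrite mul0r.
by have := congr1 mdeg mij; rewrite ia mdegD => E; rewrite {1}E ltnNge leq_addr in ma.
Qed.

(** Cutting the geometric series after exponent [d] leaves a remainder divisible by z^((d+1)a),
    hence of degree above [d] because [a] is nonzero. The exponent [(0 < k)] yields coefficient 1 at
    k = 0 and 1 - c afterwards. *)
Lemma root_factor_upto d c a : a != 0%MM ->
  fps_eq_upto d.+1 ((1 - c *: 'z^a) / (1 - 'z^a))
    (\sum_(k < d.+1) (1 - c) ^+ (0 < k)%N *: 'z^(a *+ k)).
Proof.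
move=> a0 m md.
have ua : 1 - 'z^a \is a @GRing.unit (fps n R).
  by apply: fps_unit1B; rewrite fcoefX eq_sym (negPf a0).
pose z : fps n R := 'z^a; pose y := c%:A : fps n R.
have -> : (1 - c *: 'z^a) / (1 - 'z^a) =
    (\sum_(k < d.+1) (1 - c) ^+ (0 < k)%N *: 'z^(a *+ k)) +
    'z^(a *+ d.+1) * ((1 - y) / (1 - z)).
  apply: (mulIr ua); rewrite divrK // mulrDl fpsXMn -mulrA -/z divrK //.
  have -> : \sum_(k < d.+1) (1 - c) ^+ (0 < k)%N *: 'z^(a *+ k) =
      1 + (1 - y) * (z * \sum_(k < d) z ^+ k).
    rewrite big_ord_recl /= expr0 scale1r mulm0n; congr (_ + _).
    rewrite !mulr_sumr; apply: eq_bigr => k _.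
    by rewrite /bump /= add1n expr1 fpsXMn exprS scalerBl scale1r mulrBl mul1r
      -scalerAl mul1r.
  have E : (\sum_(k < d) z ^+ k) * (1 - z) = 1 - z ^+ d.
    by rewrite mulrC -[RHS]opprB subrX1 -mulNr opprB.
  have -> : c *: z = y * z by rewrite -scalerAl mul1r.
  (* The product of the partial sum with 1 - z is isolated so that [E] telescopes it. *)
  transitivity (1 - z + (1 - y) * z * ((\sum_(k < d) z ^+ k) * (1 - z))
     + z ^+ d.+1 * (1 - y)); last by ring.
  by rewrite E exprS; ring.
rewrite fcoefD fcoef_fpsXM_lt ?addr0 // mdegMn.
by apply: leq_trans md _; rewrite leq_pmull // lt0n mdeg_eq0.
Qed.

End Monomials.

(** * Weakly increasing rows with prescribed multiplicities *)

Local Open Scope nat_scope.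

Lemma big_iotaS (R : Type) (idx : R) (op : R -> R -> R) (F : nat -> R) i n :
  \big[op/idx]_(k <- iota i.+1 n) F k.-1 = \big[op/idx]_(k <- iota i n) F k.
Proof. by rewrite -[i.+1]add1n iotaDl big_map. Qed.

Definition mrow (g : nat -> nat) lo n : seq nat :=
  flatten [seq nseq (g k) k | k <- iota lo n].

Lemma mrowS g lo n : mrow g lo n.+1 = nseq (g lo) lo ++ mrow g lo.+1 n.
Proof. by []. Qed.

Lemma count_mrow g lo n x :
  count_mem x (mrow g lo n) = if lo <= x < lo + n then g x else 0.
Proof.
elim: n lo => [|n IHn] lo; first by rewrite addn0; case: ifP => //; lia.
rewrite mrowS count_cat count_nseq IHn /=; case: eqVneq => [<-|lox].
  by rewrite mul1n leqnn ltnn addn0 addnS ltnS leq_addr.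
by rewrite mul0n add0n; congr (if _ then _ else _); lia.
Qed.

Lemma mem_mrow g lo n x : x \in mrow g lo n -> lo <= x < lo + n.
Proof. by rewrite -has_pred1 has_count count_mrow; case: ifP. Qed.

Lemma size_mrow g lo n : size (mrow g lo n) = \sum_(k <- iota lo n) g k.
Proof.
elim: n lo => [|n IHn] lo; first by rewrite big_nil.
by rewrite mrowS size_cat size_nseq IHn big_cons.
Qed.

Lemma sorted_mrow g lo n : sorted leq (mrow g lo n).
Proof.
elim: n lo => [|n IHn] lo //; rewrite mrowS.
rewrite sorted_pairwise; last exact: leq_trans.
rewrite pairwise_cat -!sorted_pairwise; try exact: leq_trans.
rewrite IHn andbT; apply/andP; split.
  by apply/allrelP => x y /nseqP[-> _] /mem_mrow; lia.
by elim: (g lo) => [|[|k] IHk] //=; rewrite leqnn.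
Qed.

(** A sorted word is determined by the multiplicities of its letters, and outside the given range
    both counts are zero. *)
Lemma mrow_count (s : seq nat) lo n : sorted leq s ->
  (forall x, x \in s -> lo <= x < lo + n) ->
  s = mrow (fun k => count_mem k s) lo n.
Proof.
move=> ss sb; apply: (sorted_eq leq_trans anti_leq ss (sorted_mrow _ _ _)).
apply/allP => x _ /=; rewrite count_mrow; case: ifPn => //.
by apply: contraNT; rewrite -lt0n -has_count has_pred1 => /sb.
Qed.

Lemma eq_mrow g g' lo n : (forall k, lo <= k < lo + n -> g k = g' k) ->
  mrow g lo n = mrow g' lo n.
Proof.
move=> gg'; congr flatten; apply/eq_in_map => k; rewrite mem_iota => /gg' -> //.
Qed.

Lemma sum_mrow p (F : nat -> 'X_{1..p}) (P : pred nat) g lo n :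
  (\sum_(k <- mrow g lo n | P k) F k =
   \sum_(k <- iota lo n | P k) F k *+ g k)%MM.
Proof.
elim: n lo => [|n IHn] lo; first by rewrite !big_nil.
rewrite mrowS big_cat big_cons IHn /=.
suff -> : (\sum_(k <- nseq (g lo) lo | P k) F k =
           if P lo then F lo *+ g lo else 0)%MM.
  by case: ifP => // _; rewrite add0m.
elim: (g lo) => [|k IHk]; first by rewrite big_nil mulm0n if_same.
by rewrite big_cons IHk; case: (P lo); rewrite ?mulmS.
Qed.

(** * The tableau with prescribed multiplicities, its weight and its segments *)

(** The length that marginal largeness forces on row [i]: row a is longer than row a+1 by one plus
    the number of its entries exceeding a, and these differences telescope. *)
Definition tab_len r (c : nat -> nat -> nat) i :=
  \sum_(i <= a < r.+1) (\sum_(a <= j < r.+1) c a j).+1.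

(* [c i j] counts the entries [j.+1] of row [i], that is, the boxes contributing
   alpha_i + ... + alpha_j; the entries [i] are forced by marginal largeness. *)
Definition tab_mult r c i k :=
  if k == i then (tab_len r c i.+1).+1 else c i k.-1.

Definition tab_row r c i := mrow (tab_mult r c i) i (r.+2 - i).

Definition tab r c : tableau := [seq tab_row r c i | i <- iota 1 r].

Section Tab.
Variables (r : nat) (c : nat -> nat -> nat).

Lemma trow_tab i : 0 < i ->
  trow (tab r c) i = if i <= r then tab_row r c i else [::].
Proof.
case: i => // i _; rewrite /trow /tab /=; case: ifP => ir.
  by rewrite (nth_map 0) ?size_iota // nth_iota.
by rewrite nth_default // size_map size_iota leqNgt ir.
Qed.

Lemma tab_rowE i : i <= r ->
  tab_row r c i =
  nseq (tab_len r c i.+1).+1 i ++ mrow (fun k => c i k.-1) i.+1 (r.+1 - i).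
Proof.
move=> ir; rewrite /tab_row subSn ?leqW // mrowS /tab_mult eqxx.
by congr (_ ++ _); apply: eq_mrow => k; case: eqVneq => // ->; lia.
Qed.

Lemma tab_lenS i : i <= r ->
  tab_len r c i = (\sum_(i <= j < r.+1) c i j).+1 + tab_len r c i.+1.
Proof. by move=> ir; rewrite {1}/tab_len big_ltn. Qed.

Lemma size_tab_row i : i <= r -> size (tab_row r c i) = tab_len r c i.
Proof.
move=> ir; rewrite tab_rowE // size_cat size_nseq size_mrow (tab_lenS ir).
by rewrite (big_iotaS _ _ (c i)) addSn addnC.
Qed.

Lemma count_tab_row i k : i <= r -> i < k -> k <= r.+1 ->
  count_mem k (tab_row r c i) = c i k.-1.
Proof.
move=> ir ik kr; rewrite /tab_row count_mrow /tab_mult.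
by rewrite (gtn_eqF ik) ifT //; lia.
Qed.

Lemma count_tab_row_diag i : i <= r ->
  count_mem i (tab_row r c i) = (tab_len r c i.+1).+1.
Proof. by move=> ir; rewrite /tab_row count_mrow /tab_mult eqxx ifT //; lia. Qed.

Lemma tab_lenSr : tab_len r c r.+1 = 0.
Proof. by rewrite /tab_len big_geq. Qed.

Lemma size_trow_tab i : 0 < i -> i <= r.+1 ->
  size (trow (tab r c) i) = tab_len r c i.
Proof.
move=> i0 ir; rewrite trow_tab //; case: (leqP i r) => [/size_tab_row//|ri].
by have -> : i = r.+1 by [lia]; rewrite tab_lenSr.
Qed.

Lemma tab_Tinf : Tinf r (tab r c).
Proof.
split.
- apply/allP => _ /mapP[i + ->]; rewrite mem_iota => ir.
  by apply/allP => x /mem_mrow; lia.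
- split; last by rewrite size_map size_iota.
  split.
  + apply/mapP => -[i]; rewrite mem_iota => ir.
    by rewrite tab_rowE //; lia.
  + rewrite /tab -map_comp; apply/(sortedP 0) => i; rewrite size_map size_iota => ir.
    rewrite !(nth_map 0) ?size_iota ?(ltnW ir) // !nth_iota ?(ltnW ir) //=.
    rewrite !add1n !size_tab_row ?(ltnW ir) //.
    by rewrite (tab_lenS (ltnW ir)) leq_addl.
  + by apply/allP => _ /mapP[i _ ->]; apply: sorted_mrow.
  (* Row j starts with one more copy of j than row j+1 has boxes, so every box of row j+1 lies below
     an entry j, while its own entry is at least j+1. *)
  + move=> j k j0; rewrite !trow_tab //; case: (ltnP j r) => // jr.
    rewrite (ltnW jr) => kj; move: (kj); rewrite size_tab_row // => kj'.
    rewrite tab_rowE ?(ltnW jr) // nth_cat size_nseq ltnS (ltnW kj') nth_nseq.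
    rewrite ltnS (ltnW kj').
    by have /mem_mrow/andP[] := mem_nth 0 kj.
- by move=> j /andP[j0 jr]; rewrite trow_tab // jr tab_rowE.
- move=> i /andP[i0 ir]; rewrite size_trow_tab // trow_tab // ir.
  exact: count_tab_row_diag.
Qed.

Lemma neg_wt_tab : neg_wt r (tab r c) =
  (\sum_(i <- iota 1 r) \sum_(j <- iota i (r.+1 - i)) root_sum r i j *+ c i j)%MM.
Proof.
rewrite /neg_wt /index_iota subSS subn0; apply: eq_big_seq => i.
rewrite mem_iota => /andP[i0 ir]; rewrite trow_tab // ifT; last by lia.
rewrite tab_rowE; last by lia.
(* The initial block of entries [i] fails the condition i < k and adds nothing to the weight. *)
rewrite big_cat /= big_seq_cond big_pred0 => [|k]; last first.
  by rewrite in_cons mem_nseq; case: eqVneq => [->|_]; rewrite ?ltnn ?andbF.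
rewrite add0m sum_mrow -big_iotaS big_seq_cond [RHS]big_seq.
apply: eq_bigl => k; rewrite mem_iota; lia.
Qed.

Lemma seg_tab : seg r (tab r c) =
  \sum_(i <- iota 1 r) \sum_(j <- iota i (r.+1 - i)) (0 < c i j).
Proof.
(* In a sorted row the entry k forms one run or none. The bound i < k becomes a filter, so that the
   range of i no longer depends on k and the sums can be exchanged. *)
rewrite /seg /seg_at (eq_big_nat _ _ (F2 := fun k =>
  \sum_(1 <= i < r.+1 | i < k) (0 < c i k.-1))); last first.
  move=> k /andP[k1 kr].
  rewrite (big_nat_widen _ _ r.+1) ?(leq_trans _ kr) // big_nat_cond.
  rewrite [RHS]big_nat_cond; apply: eq_bigr => i /andP[/andP[i0 ir] ik].
  rewrite trow_tab // ifT // size_runs; last exact: sorted_mrow.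
  by rewrite -has_pred1 has_count count_tab_row.
rewrite (exchange_big_dep_nat predT) //= /index_iota subSS subn0.
apply: eq_big_seq => i; rewrite mem_iota => /andP[i0 ir].
rewrite -big_iotaS -big_filter; apply: perm_big.
apply: uniq_perm => [||k]; rewrite ?filter_uniq ?iota_uniq //.
by rewrite mem_filter !mem_iota; lia.
Qed.

End Tab.

(** Allows the counts read off an arbitrary tableau to be replaced by a finite table that agrees
    with them on the positive roots. *)
Lemma eq_tab r c c' :
  (forall i j, 0 < i -> i <= j -> j <= r -> c i j = c' i j) ->
  tab r c = tab r c'.
Proof.
move=> cc'; apply/eq_in_map => i; rewrite mem_iota => /andP[i0 ir].
apply: eq_mrow => k ik; rewrite /tab_mult; case: eqVneq => [_|ki].
  congr S; apply: eq_big_nat => a ai; congr S; apply: eq_big_nat => j aj.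
  by apply: cc'; lia.
by apply: cc'; lia.
Qed.

(* The shape of a marginally large tableau is forced from the bottom row up. *)
Lemma Tinf_tab r b : Tinf r b ->
  b = tab r (fun i j => count_mem j.+1 (trow b i)).
Proof.
case=> /allP bb [[b0 bsz /allP bs bcol] br] bh bm; set c := fun i j => _.
have inb i : 0 < i -> i <= r -> trow b i \in b.
  by move=> i0 ir; rewrite /trow mem_nth // br; lia.
have rowE i : 0 < i -> i <= r ->
    trow b i = mrow (fun k => count_mem k (trow b i)) i (r.+2 - i).
  move=> i0 ir; apply: mrow_count; first by apply/bs/inb.
  move=> x xi; have /allP/(_ x xi) := bb _ (inb i i0 ir).
  have := bh i; rewrite i0 ir => /(_ isT).
  have := bs _ (inb i i0 ir); case: (trow b i) xi => //= y s.
  rewrite inE => + /(order_path_min leq_trans)/allP ys yi; rewrite yi in ys *.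
  (* Row [i] is sorted and its first entry is [i], so all its entries are at least [i]. *)
  by case/orP => [/eqP->|/ys]; lia.
have multE i k : 0 < i -> i <= r -> size (trow b i.+1) = tab_len r c i.+1 ->
    i <= k -> count_mem k (trow b i) = tab_mult r c i k.
  move=> i0 ir si ik; rewrite /tab_mult; case: eqVneq => [->|ki].
    by rewrite bm ?i0 // si.
  by rewrite /c prednK //; lia.
(* Here [n] is the distance to the empty row r+1, so the induction climbs from the bottom. *)
have szE n i : i + n = r.+1 -> 0 < i -> size (trow b i) = tab_len r c i.
  elim: n i => [|n IHn] i; rewrite ?addn0 => irn i0.
    by rewrite irn tab_lenSr /trow nth_default // br.
  have si : size (trow b i.+1) = tab_len r c i.+1 by apply: IHn; lia.
  rewrite rowE -?(size_tab_row c); try lia.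
  by congr size; apply: eq_mrow => k ik; apply: multE; lia.
apply: (@eq_from_nth _ [::]) => [|i]; rewrite ?size_map ?size_iota // br => ir.
rewrite (nth_map 0) ?size_iota // nth_iota // -[nth _ b i]/(trow b i.+1) rowE //.
apply: eq_mrow => k ik; apply: multE => //; last by lia.
by apply: (szE (r.+1 - i.+2)); lia.
Qed.

(** * Factorization of a tableau's term over the positive roots *)

Local Open Scope ring_scope.

(** Passes from 1-based nested intervals to pairs in one finite type, as needed to distribute a
    product of sums over choice functions. *)
Lemma big_root_pairs (R : Type) (idx : R) (op : Monoid.com_law idx)
    r (F : nat -> nat -> R) :
  \big[op/idx]_(i <- iota 1 r) \big[op/idx]_(j <- iota i (r.+1 - i)) F i j =
  \big[op/idx]_(p : 'I_r * 'I_r | (p.1 <= p.2)%N) F p.1.+1 p.2.+1.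
Proof.
rewrite -(pair_big_dep predT (fun i j : 'I_r => (i <= j)%N)
  (fun i j : 'I_r => F i.+1 j.+1)) /=.
rewrite -(addn0 1%N) iotaDl big_map -[in iota 0 _](subn0 r) big_mkord.
apply: eq_bigr => i _; rewrite add1n subSS -(addn1 i) addnC iotaDl big_map.
rewrite big_geq_mkord; exact: eq_bigl.
Qed.

Definition filling r d (f : {ffun 'I_r.+1 * 'I_r.+1 -> 'I_d.+1}) (i j : nat) :
  nat := f (inord i.-1, inord j.-1).

Definition tab_term r (b : tableau) : fps r {poly int} :=
  (1 - tinv) ^+ seg r b *: 'z^(neg_wt r b).

(** The weight and the number of segments are both sums over pairs i <= j, so the term splits into
    factors, each a summand of a truncated series in [root_factor_upto]. *)
Lemma tab_term_prod r c : tab_term r (tab r c) =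
  \prod_(p : 'I_r * 'I_r | (p.1 <= p.2)%N)
    ((1 - tinv) ^+ (0 < c p.1.+1 p.2.+1)%N *:
       'z^(root_sum r p.1.+1 p.2.+1 *+ c p.1.+1 p.2.+1)).
Proof.
rewrite scaler_prod prodrXr -fpsX_sum /tab_term seg_tab neg_wt_tab.
by rewrite !(big_root_pairs _ r).
Qed.

Lemma root_sum_neq0 r i j : (0 < i)%N -> (i <= j)%N -> (j <= r)%N ->
  root_sum r i j != 0%MM.
Proof.
case: i => // i _ ij jr; apply/eqP => /mnmP /(_ (Ordinal (leq_trans ij jr))).
by rewrite root_sumE mnm0E /= leqnn ij.
Qed.

(** Each entry j+1 in row i contributes a nonzero root. Fixing the weight therefore bounds every
    multiplicity, leaving finitely many tableaux. *)
Lemma leq_mdeg_neg_wt r c i j : (0 < i)%N -> (i <= j)%N -> (j <= r)%N ->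
  (c i j <= mdeg (neg_wt r (tab r c)))%N.
Proof.
case: i j => [//|i] [//|j] _ ij jr.
have ir : (i < r)%N by apply: leq_trans jr.
rewrite neg_wt_tab (big_root_pairs _ r) mdeg_sum.
rewrite (bigD1 (Ordinal ir, Ordinal jr)) //= mdegMn.
apply: leq_trans (leq_addr _ _).
by rewrite leq_pmull // lt0n mdeg_eq0 root_sum_neq0.
Qed.

(** * Comparison of the coefficients at a fixed monomial *)

Section Coefficient.
Variables (r : nat) (m : 'X_{1..r.+1}).
Let d := mdeg m.
Let P (p : 'I_r.+1 * 'I_r.+1) := (p.1 <= p.2)%N.
(** One multiplicity at most [d] for each positive root; the value [ord0] on the remaining pairs
    makes a filling recoverable from its tableau. *)
Let fillings : seq {ffun 'I_r.+1 * 'I_r.+1 -> 'I_d.+1} :=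
  enum (pfamily ord0 P (fun=> predT)).
Let tabs := [seq tab r.+1 (filling f) | f <- fillings].

(** Up to degree [d] every factor may be truncated; expanding the finite product selects one
    exponent per root, that is, one filling. *)
Lemma fcoef_root_prod :
  fcoef (\prod_(a <- pos_roots r.+1) ((1 - tinv *: 'z^a) / (1 - 'z^a))) m =
  \sum_(b <- tabs) fcoef (tab_term r.+1 b) m.
Proof.
rewrite big_allpairs_dep (big_root_pairs _ r.+1) /=.
transitivity (fcoef (\prod_(p | P p) \sum_(k < d.+1)
    (1 - tinv) ^+ (0 < k)%N *: 'z^(root_sum r.+1 p.1.+1 p.2.+1 *+ k)) m).
  apply: fps_eq_upto_prod (ltnSn d) => p p12; apply: root_factor_upto.
  exact: root_sum_neq0.
rewrite (big_distr_big_dep ord0) fcoef_sum big_map big_enum.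
apply: eq_bigr => f _; rewrite -[RHS]/(fcoef (tab_term _ (tab _ _)) m).
rewrite tab_term_prod; congr (fcoef _ m).
by apply: eq_bigr => -[i j] _; rewrite /filling /= !inord_val.
Qed.

Lemma uniq_tabs : uniq tabs.
Proof.
rewrite map_inj_in_uniq ?enum_uniq // => f g.
rewrite !mem_enum => /pfamilyP[/supportP f0 _] /pfamilyP[/supportP g0 _] fg.
apply/ffunP => -[i j]; have [ij|ij] := boolP (P (i, j)); last first.
  by rewrite f0 ?g0.
(* The 0-based pair (i, j) stands for row i+1 and entry j+2, whose count gives back the value of the
   filling. *)
have := congr1 (fun b => count_mem j.+2 (trow b i.+1)) fg.
rewrite !trow_tab // ltn_ord !count_tab_row //; try exact: (ltn_ord j).
rewrite /filling /= !inord_val.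
exact: val_inj.
Qed.

Lemma tabs_Tinf b : b \in tabs -> Tinf r.+1 b.
Proof. by case/mapP => f _ ->; apply: tab_Tinf. Qed.

(** A nonzero coefficient forces [m] to be the weight of [b], so all multiplicities of [b] are at
    most [d] and form a filling. *)
Lemma mem_tabs b : Tinf r.+1 b -> fcoef (tab_term r.+1 b) m <> 0 -> b \in tabs.
Proof.
move=> /Tinf_tab; set c := fun i j => _ => -> cm.
have Em : m = neg_wt r.+1 (tab r.+1 c).
  apply/eqP; apply: contra_notT cm => /negPf ne.
  by rewrite fcoefZ fcoefX ne mulr0.
have cd i j : (0 < i)%N -> (i <= j)%N -> (j <= r.+1)%N -> (c i j < d.+1)%N.
  by move=> *; rewrite ltnS /d Em leq_mdeg_neg_wt.
apply/mapP; exists [ffun p => if P p then inord (c p.1.+1 p.2.+1) else ord0].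
  rewrite mem_enum; apply/pfamilyP; split=> //.
  by apply/supportP => p /negPf Pp; rewrite ffunE [P p]Pp.
apply: eq_tab => -[//|i] [//|j] _ ij jr.
have ir : (i < r.+1)%N by apply: leq_trans jr.
rewrite /filling ffunE /P /= !inordK // -ltnS ij inordK //; exact: cd.
Qed.

(** The finite list consists of tableaux in [Tinf] and contains all those with nonzero coefficient
    at [m], so it computes the infinite sum there. *)
Lemma fcoef_fps_sum_tabs :
  fcoef (fps_sum (Tinf r.+1) (tab_term r.+1)) m =
  \sum_(b <- tabs) fcoef (tab_term r.+1 b) m.
Proof.
rewrite /fps_sum /= (fsbigE tabs) ?uniq_tabs //.
- rewrite big_seq_cond [RHS]big_seq; apply: eq_bigl => b.
  by case: (boolP (b \in tabs)) => //= /tabs_Tinf /mem_set.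
- by move=> b /= /tabs_Tinf.
- move=> b Tb; apply: contraNeq => /eqP; exact: mem_tabs.
Qed.

Lemma finite_tab_term_support :
  finite_set [set b | Tinf r.+1 b /\ fcoef (tab_term r.+1 b) m <> 0].
Proof.
apply: (@sub_finite_set _ _ [set` tabs]); last exact: finite_seq.
by move=> b /= [Tb]; apply: mem_tabs.
Qed.

End Coefficient.

Theorem theorem3p2 (r : nat) (hr : (1 <= r)%N) :
  let term (b : tableau) : fps r {poly int} :=
    (1 - tinv) ^+ seg r b *: 'z^(neg_wt r b) in
  fps_summable (Tinf r) term /\
  \prod_(a <- pos_roots r) ((1 - tinv *: 'z^a) / (1 - 'z^a)) =
    fps_sum (Tinf r) term.
Proof.
case: r hr => [//|r] _; split; first by move=> m; apply: finite_tab_term_support.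
by apply/fpsP => m; rewrite fcoef_root_prod -fcoef_fps_sum_tabs.
Qed.
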